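(* Let $K$ be a number field with ring of integers $\mathcal{O}_K$. Every nonzero principal ideal $\mathfrak{A}\subseteq\mathcal{O}_K$ such that $n(\mathfrak{A})>\rho_\infty(K)$ is strictly large. Therefore all but finitely many integral principal ideals of $\mathcal{O}_K$ are strictly large.
   Context: Let $K$ be a number field of degree $d$ with $r_1$ real embeddings $\sigma_1,\dots,\sigma_{r_1}$ and $r_2$ pairs of complex conjugate embeddings, represented by $\sigma_{r_1+1},\dots,\sigma_{r_1+r_2}$; put $s=r_1+r_2$, and let $\Sigma$ be the set of all $d$ embeddings $K\to\mathbb{C}$. Largeness: $x\in\mathcal{O}_K$ is strictly large if $|\sigma(x)|>1$ for every $\sigma\in\Sigma$. An ideal of $\mathcal{O}_K$ is strictly large if it is principal and has a strictly large generator. Logarithmic norm: for a nonzero ideal $\mathfrak{A}\subseteq\mathcal{O}_K$, $n(\mathfrak{A})=\frac{\log N_{K/\mathbb{Q}}(\mathfrak{A})}{[K:\mathbb{Q}]}$, where $N_{K/\mathbb{Q}}(\mathfrak{A})=\#(\mathcal{O}_K/\mathfrak{A})$. Covering radius: the logarithmic embedding $\ell:K^\times\to\mathbb{R}^s$ is $\ell(x)=(\log|\sigma_1(x)|,\dots,\log|\sigma_{r_1}(x)|,2\log|\sigma_{r_1+1}(x)|,\dots,2\log|\sigma_{r_1+r_2}(x)|)$, and $\Lambda_K=\ell(\mathcal{O}_K^\times)$, a lattice of rank $s-1$ in $\mathbb{R}^s$. Then $\rho_\infty(K)=\sup_{v\in\mathrm{span}_{\mathbb R}(\Lambda_K)}\min_{w\in\Lambda_K}\|v-w\|_\infty$,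 where $\|\cdot\|_\infty$ is the sup norm on $\mathbb{R}^s$. *)

(* Defs.v *)
From HB Require Import structures.
From mathcomp Require Import all_boot all_order all_algebra all_field.
From mathcomp Require Import finmap complex.
From mathcomp Require Import all_classical all_reals all_analysis.
Set Implicit Arguments.
Unset Strict Implicit.
Unset Printing Implicit Defensive.
Import Order.TTheory GRing.Theory Num.Theory.
Import numFieldNormedType.Exports.
Local Open Scope classical_set_scope.
Local Open Scope ring_scope.

(* A number field is a K : fieldExtType rat, i.e. a field that is
   finite-dimensional over the rationals; [K : Q] is \dim {:K}. *)

Definition integral_elt (K : fieldExtType rat) : {pred K} :=
  fun x => `[< integralOver (intr : int -> K) x >].

Lemma integral_elt_subring (K : fieldExtType rat) :
  subring_closed (@integral_elt K).
Proof.
split=> [|x y /asboolP ix /asboolP iy|x y /asboolP ix /asboolP iy];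
  apply/asboolP.
- exact: integral1.
- exact: integral_sub.
- exact: integral_mul.
Qed.

HB.instance Definition _ (K : fieldExtType rat) :=
  GRing.isSubringClosed.Build K (@integral_elt K) (@integral_elt_subring K).

Record ring_of_integers (K : fieldExtType rat) : Type := RingOfIntegers {
  OK_val :> K;
  OK_valP : OK_val \in @integral_elt K
}.

Section RingOfIntegersStructure.
Variable K : fieldExtType rat.
HB.instance Definition _ := [isSub for @OK_val K].
HB.instance Definition _ := [Choice of ring_of_integers K by <:].
HB.instance Definition _ :=
  [SubChoice_isSubComNzRing of ring_of_integers K by <:].
End RingOfIntegersStructure.

Definition is_OK_unit (K : fieldExtType rat) (u : ring_of_integers K) : Prop :=
  exists v : ring_of_integers K, u * v = 1.

Definition ideal_gen (A : comNzRingType) (x : A) : set A :=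
  [set x * y | y in [set: A]].

Definition is_principal (A : comNzRingType) (I : set A) : Prop :=
  exists x, I = ideal_gen x.

Definition residue_classes (A : comNzRingType) (I : set A) : set (set A) :=
  [set [set x + a | a in I] | x in [set: A]].

(* #(A / I), with value 0 if A / I is infinite; for A = ring_of_integers K and
   I an ideal, that happens only for I = 0. *)
Definition ideal_norm (A : comNzRingType) (I : set A) : nat :=
  #|` fset_set (residue_classes I)|.

Definition log_norm (R : realType) (K : fieldExtType rat)
    (I : set (ring_of_integers K)) : R :=
  ln (ideal_norm I)%:R / (\dim {:K})%:R.

Definition cmod (R : realType) (z : R[i]) : R := Normc.normc z.

Definition strictly_large_elt (R : realType) (K : fieldExtType rat)
    (x : ring_of_integers K) : Prop :=
  forall sigma : {rmorphism K -> R[i]}, 1 < cmod (sigma (x : K)).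

Definition strictly_large (R : realType) (K : fieldExtType rat)
    (I : set (ring_of_integers K)) : Prop :=
  exists x : ring_of_integers K, I = ideal_gen x /\ strictly_large_elt R x.

(* sigma lists the r1 real embeddings of K, followed by one embedding from
   each of the r2 pairs of complex conjugate non-real embeddings. *)
Record is_place_enum (R : realType) (K : fieldExtType rat) (r1 r2 : nat)
    (sigma : 'I_(r1 + r2) -> {rmorphism K -> R[i]}) : Prop := IsPlaceEnum {
  place_real : forall (i : 'I_r1) x, complex.Im (sigma (lshift r2 i) x) = 0;
  place_nonreal : forall j : 'I_r2,
    exists x, complex.Im (sigma (rshift r1 j) x) <> 0;
  place_exhaustive : forall tau : {rmorphism K -> R[i]},
    exists! i, tau =1 sigma i \/ tau =1 (fun x => conjc (sigma i x))
}.

Section LogEmbedding.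
Variables (R : realType) (K : fieldExtType rat) (r1 r2 : nat).
Variable sigma : 'I_(r1 + r2) -> {rmorphism K -> R[i]}.

Definition log_embedding (x : K) : 'rV[R]_(r1 + r2) :=
  row_mx (\row_(i < r1) ln (cmod (sigma (lshift r2 i) x)))
         (\row_(j < r2) (2 * ln (cmod (sigma (rshift r1 j) x)))).

Definition log_unit_lattice : set 'rV[R]_(r1 + r2) :=
  [set log_embedding u | u in [set u : ring_of_integers K | is_OK_unit u]].

Definition log_unit_span : set 'rV[R]_(r1 + r2) :=
  [set v | exists2 X : seq 'rV[R]_(r1 + r2),
     (forall w, w \in X -> log_unit_lattice w) & v \in <<X>>%VS].

(* The norm on row vectors is the sup norm. *)
Definition covering_radius : \bar R :=
  ereal_sup [set ereal_inf [set `|v - w|%:E | w in log_unit_lattice]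
            | v in log_unit_span].

End LogEmbedding.

(* Main.v *)
Require Import Defs.
From HB Require Import structures.
From mathcomp Require Import all_boot all_order all_algebra all_field.
From mathcomp Require Import complex.
From mathcomp Require Import all_classical all_reals all_analysis.
From mathcomp Require Import ring lra.
Set Implicit Arguments.
Unset Strict Implicit.
Unset Printing Implicit Defensive.
Import Order.TTheory GRing.Theory Num.Theory.
Import numFieldNormedType.Exports.
Local Open Scope classical_set_scope.
Local Open Scope ring_scope.

(* The norm of a principal ideal (a) is the product of the |tau(a)| over all
   embeddings tau, so l(a) - n(a) * (1,..,1,2,..,2) has coordinate sum 0.  The
   unit theorem puts this vector in the real span of the log-unit lattice; a
   unit u with |l(a) - n(a) * (1,..,1,2,..,2) - l(u)| < n(a) makes a/u strictly
   large.

   The unit theorem is needed in the form: for some constant C and all positive,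
   conjugation-invariant weights t with product 1, some unit u has
   |tau(u)| <= C t(tau) for every tau.  Pigeonhole on integer combinations of an
   integral basis gives a nonzero integer a with |tau(a)| <= C1 t(tau); its norm
   is at most C1^d, and there are finitely many ideals of bounded norm, so a is
   a unit times one of finitely many generators.  Hence the log-unit lattice is
   cobounded in the hyperplane of coordinate sum 0, so it spans it.  Applied to
   t(tau) = |tau(a)| / N(a)^(1/d) the same statement shows that every principal
   ideal of large enough norm is strictly large. *)

(** * Embeddings of a number field *)

Section Embeddings.
Variables (K : fieldExtType rat) (C : numClosedFieldType).

Lemma separable_numField (x : K) : separable_element 1 x.
Proof. by apply: pcharf0_separable => p; rewrite pchar_lalg pchar_num. Qed.

Lemma primitive_element :
  exists theta : K, <<1; theta>>%VS = fullv.
Proof.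
exists (separable_generator 1 {:K}).
rewrite -eq_adjoin_separable_generator ?subvf //.
by apply/separableP => y _; apply: separable_numField.
Qed.

Lemma rmorph_horner_in_alg (sigma : {rmorphism K -> C}) p theta :
  sigma (map_poly (in_alg K) p).[theta] = (map_poly ratr p).[sigma theta].
Proof.
rewrite -horner_map /= -map_poly_comp; congr (_.[_]).
by apply: eq_map_poly => a /=; rewrite alg_num_field fmorph_rat.
Qed.

(** Every element of [K] is a polynomial in [theta]; evaluating it at [z] instead is well defined,
    since two such polynomials differ by a multiple of the minimal polynomial, which vanishes at
    [z]. *)
Lemma rmorphism_of_root (theta : K) (q : {poly rat}) (z : C) :
  <<1; theta>>%VS = fullv ->
  minPoly 1 theta = map_poly (in_alg K) q ->
  root (map_poly ratr q) z ->
  exists sigma : {rmorphism K -> C}, sigma theta = z.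
Proof.
move=> gen qE rz.
have /choice[s sE] (x : K) :
    exists p : {poly rat}, x = (map_poly (in_alg K) p).[theta].
  by apply/Fadjoin1_polyP; rewrite gen memvf.
pose f x := (map_poly ratr (s x)).[z].
have fE p x : x = (map_poly (in_alg K) p).[theta] ->
    f x = (map_poly ratr p).[z].
  move=> xE; apply/eqP; rewrite -subr_eq0 /f -hornerN -hornerD -rmorphB /=.
  have /dvdpP[r ->] : q %| s x - p.
    rewrite -(dvdp_map (in_alg K)) -qE.
    apply: minPoly_dvdp; first exact: alg_polyOver.
    by rewrite /root rmorphB /= hornerD hornerN -sE -xE subrr.
  by rewrite rmorphM hornerM (rootP rz) mulr0.
have fB : zmod_morphism f.
  move=> x y; rewrite (fE (s x - s y)) ?rmorphB /= ?hornerD ?hornerN //.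
  by rewrite -!sE.
have fM : monoid_morphism f.
  split=> [|x y]; first by rewrite (fE 1) ?rmorph1 ?hornerC.
  by rewrite (fE (s x * s y)) ?rmorphM /= ?hornerM // -!sE.
pose fa := GRing.isZmodMorphism.Build _ _ f fB.
pose fm := GRing.isMonoidMorphism.Build _ _ f fM.
pose fR : {rmorphism K -> C} := HB.pack f fa fm.
exists fR; rewrite -[LHS]/(f theta) (fE 'X) ?map_polyX ?hornerX //.
Qed.

(** The minimal polynomial of a primitive element is separable, so it has [\dim {:K}] distinct roots
    in [C]; each gives an embedding, and every embedding sends the element to one of them. *)
Lemma exists_embeddings :
  exists tau : 'I_(\dim {:K}) -> {rmorphism K -> C},
    (forall sigma : {rmorphism K -> C}, exists i, sigma =1 tau i) /\
    exists theta : K, injective (fun i => tau i theta).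
Proof.
have [theta gen] := primitive_element.
have /polyOver1P[q qE] := minPolyOver 1 theta.
have q_mon : q \is monic.
  by rewrite -(map_monic (in_alg K)) -qE monic_minPoly.
have szq : size q = (\dim {:K}).+1.
  rewrite -(size_map_poly (in_alg K)) -qE size_minPoly.
  by rewrite -gen (dim_Fadjoin 1 theta) dimv1 muln1.
have [rs rsE] := closed_field_poly_normal (map_poly (ratr : rat -> C) q).
rewrite lead_coef_map (monicP q_mon) rmorph1 scale1r in rsE.
have szrs : size rs = \dim {:K}.
  have := size_map_poly (ratr : {rmorphism rat -> C}) q.
  by rewrite [map_poly _ _]rsE size_prod_XsubC szq => -[].
have rs_uniq : uniq rs.
  rewrite -separable_prod_XsubC -rsE separable_map.
  rewrite -(separable_map (in_alg K)) -qE.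
  exact: separable_numField.
have rrs z : root (map_poly ratr q) z = (z \in rs).
  by rewrite rsE root_prod_XsubC.
have /choice[tau tauE] (i : 'I_(\dim {:K})) :
    exists sigma : {rmorphism K -> C}, sigma theta = rs`_i.
  by apply: (rmorphism_of_root gen qE); rewrite rrs mem_nth // szrs.
exists tau; split=> [sigma|]; last first.
  exists theta => i j; rewrite !tauE => /eqP.
  by rewrite nth_uniq ?szrs // => /eqP /val_inj.
have : sigma theta \in rs.
  rewrite -rrs /root -rmorph_horner_in_alg -qE minPolyxx.
  by rewrite rmorph0.
move=> /(nthP 0)[k]; rewrite szrs => ltk kE.
exists (Ordinal ltk) => x.
have /Fadjoin1_polyP[p ->] : x \in <<1; theta>>%VS by rewrite gen memvf.
by rewrite !rmorph_horner_in_alg tauE /= kE.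
Qed.

End Embeddings.

Lemma rat_integral_int (C : numClosedFieldType) (r : rat) :
  integralOver (intr : int -> C) (ratr r) -> r \is a Num.int.
Proof.
case=> p p_mon rp.
have /rootP rp0 : root (map_poly (intr : int -> rat) p) r.
  rewrite -(fmorph_root (ratr : {rmorphism rat -> C})) -map_poly_comp.
  by rewrite (eq_map_poly (g := intr)) // => a; rewrite /= ratr_int.
have: (ratr r : algC) \in Num.int.
  apply: Cint_rat_Aint; first exact: Crat_rat.
  apply: (@root_monic_Aint (map_poly intr p)); last 2 first.
  - exact: monic_map.
  - by apply/polyOverP => i; rewrite coef_map /= intr_int.
  rewrite -(eq_map_poly (f := ratr \o (intr : int -> rat))); last first.
    by move=> a; rewrite /= ratr_int.
  by rewrite map_poly_comp fmorph_root; apply/rootP.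
case/intrP=> m mE; apply/intrP; exists m.
by apply: (fmorph_inj (ratr : {rmorphism rat -> algC})); rewrite /= mE ratr_int.
Qed.

(** * Embedding matrices, norms and traces *)

Section EmbeddingMatrix.
Variables (K : fieldExtType rat) (C : numClosedFieldType).
Local Notation d := (\dim {:K}).
Variables (tau : 'I_d -> {rmorphism K -> C}) (theta : K).
Hypothesis tau_inj : injective (fun i => tau i theta).

(** Its squared determinant is the discriminant of the family [b]. *)
Definition embmx (b : 'I_d -> K) : 'M[C]_d := \matrix_(i, j) tau i (b j).

Lemma rmorph_sumZ (sigma : {rmorphism K -> C}) (c : 'I_d -> rat) b :
  sigma (\sum_j c j *: b j) = \sum_j ratr (c j) * sigma (b j).
Proof. by rewrite rmorph_sum; apply: eq_bigr => j _; rewrite rmorphZ_num. Qed.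

(** A row vector killing the matrix is a linear relation between the embeddings; on the powers of
    [theta] it is killed by a Vandermonde matrix with distinct nodes, so it is zero. *)
Lemma embmx_unit b :
  (forall x, exists c : 'I_d -> rat, x = \sum_j c j *: b j) ->
  embmx b \in unitmx.
Proof.
move=> spanb; rewrite -row_free_unit; apply/row_freeP.
apply/row_freeP; rewrite -kermx_eq0; apply/rowV0P => u /sub_kermxP uV0.
have u0 x : \sum_i u 0 i * tau i x = 0.
  have [c ->] := spanb x.
  under eq_bigr do rewrite rmorph_sumZ mulr_sumr.
  rewrite exchange_big big1 // => j _ /=.
  under eq_bigr do rewrite mulrCA.
  rewrite -mulr_sumr; move/rowP/(_ j): uV0; rewrite !mxE => uV0.
  rewrite (_ : \sum_i _ = 0) ?mulr0 // -[RHS]uV0.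
  by apply: eq_bigr => i _; rewrite mxE.
pose W := Vandermonde d (\row_i tau i theta).
have W_unit : W \in unitmx.
  rewrite unitmxE det_Vandermonde unitfE; apply/prodf_neq0 => i _.
  apply/prodf_neq0 => j lt_ij; rewrite !mxE subr_eq0.
  by apply: contraTneq lt_ij => /tau_inj ->; rewrite ltnn.
rewrite -unitmx_tr in W_unit.
rewrite -[u](mulmxK W_unit) (_ : u *m W^T = 0) ?mul0mx //.
apply/rowP => k; rewrite !mxE -[RHS](u0 (theta ^+ k)).
by apply: eq_bigr => i _; rewrite !mxE rmorphXn.
Qed.

(** The embeddings turn a rational relation among the [b j] into a kernel vector of the matrix, so
    the [b j] are free, hence a basis by dimension. *)
Lemma embmx_coord b : embmx b \in unitmx ->
  exists c : 'I_d -> K -> rat, forall x, x = \sum_j c j x *: b j.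
Proof.
move=> uV; pose X := [tuple b j | j < d].
have XE (j : 'I_d) : X`_j = b j by rewrite -tnth_nth tnth_mktuple.
have freeX : free X.
  apply/freeP => k kX j.
  pose v : 'cV[C]_d := \col_j ratr (k j).
  have : embmx b *m v = 0.
    apply/colP => i; rewrite !mxE -[RHS](rmorph0 (tau i)) -kX rmorph_sum.
    by apply: eq_bigr => l _; rewrite !mxE rmorphZ_num XE mulrC.
  move/(congr1 (mulmx (invmx (embmx b)))); rewrite mulKmx // mulmx0.
  by move/colP/(_ j); rewrite !mxE => /eqP; rewrite fmorph_eq0 => /eqP.
have basisX : basis_of {:K} X.
  by rewrite basisEfree freeX subvf size_tuple leqnn.
exists (coord X) => x; rewrite {1}(coord_basis basisX (memvf x)).
by apply: eq_bigr => j _; rewrite XE.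
Qed.

(** The embeddings diagonalise multiplication by [x]; determinants and traces then give the norm and
    trace formulas. *)
Lemma embmx_mul b x (M : 'M[rat]_d) :
  (forall j, x * b j = \sum_k M j k *: b k) ->
  diag_mx (\row_i tau i x) *m embmx b = embmx b *m (map_mx ratr M)^T.
Proof.
move=> ME; apply/matrixP => i j; rewrite mul_diag_mx !mxE -rmorphM ME.
by rewrite rmorph_sumZ; apply: eq_bigr => k _; rewrite !mxE mulrC.
Qed.

Lemma det_mul_matrix b x (M : 'M[rat]_d) : embmx b \in unitmx ->
  (forall j, x * b j = \sum_k M j k *: b k) ->
  ratr (\det M) = \prod_i tau i x.
Proof.
move=> uV /embmx_mul /(congr1 determinant).
rewrite !det_mulmx det_tr mulrC det_diag det_map_mx => /mulfI <-.
  by apply: eq_bigr => i _; rewrite mxE.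
by rewrite -unitfE -unitmxE.
Qed.

Lemma tr_mul_matrix b x (M : 'M[rat]_d) : embmx b \in unitmx ->
  (forall j, x * b j = \sum_k M j k *: b k) ->
  ratr (\tr M) = \sum_i tau i x.
Proof.
move=> uV /embmx_mul /(congr1 (mulmx (invmx (embmx b)))).
rewrite mulKmx // => /(congr1 mxtrace).
rewrite mxtrace_mulC mulmxK // mxtrace_tr mxtrace_diag.
rewrite trace_map_mx => <-.
by apply: eq_bigr => i _; rewrite mxE.
Qed.

End EmbeddingMatrix.

(** * Integral bases *)

Section IntegralScaling.
Variable K : fieldExtType rat.

Lemma integral_scaling (x : K) :
  exists2 a : int, a != 0 & integralOver (intr : int -> K) (x *~ a).
Proof.
have /polyOver1P[q qE] := minPolyOver 1 x.
have q_mon : q \is monic.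
  by rewrite -(map_monic (in_alg K)) -qE monic_minPoly.
have [p [a a_neq0 pE]] := rat_poly_scale q.
have aQ : a%:~R != 0 :> rat by rewrite intr_eq0.
have pE' : map_poly (intr : int -> rat) p = a%:~R *: q.
  by rewrite pE scalerA divff ?scale1r.
have pcoef i : (p`_i)%:~R = a%:~R * q`_i :> rat.
  by rewrite -coefZ -pE' coef_map.
have qx0 : \sum_(i < size q) q`_i *: x ^+ i = 0.
  have := minPolyxx 1 x; rewrite qE horner_coef size_map_poly => qx.
  rewrite -[RHS]qx; apply: eq_bigr => i _.
  by rewrite coef_map /= mulr_algl.
have [n szq] : exists n, size q = n.+1.
  by exists (size q).-1; rewrite prednK ?size_poly_gt0 ?monic_neq0.
have qn : q`_n = 1 by move/monicP: q_mon; rewrite lead_coefE szq.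
rewrite szq big_ord_recr /= qn scale1r in qx0.
exists a; first by rewrite a_neq0.
(* This is a^n q(X/a): its coefficient a^(n-i) q_i is the integer p_i a^(n-1-i), because p = a q. *)
pose g : {poly int} := 'X^n + \poly_(i < n) (p`_i * a ^+ (n.-1 - i)).
exists g.
  rewrite monicE lead_coefDl ?lead_coefXn // size_polyXn ltnS.
  exact: size_poly.
rewrite /root /g rmorphD /= map_polyXn hornerD hornerXn poly_def.
rewrite rmorph_sum horner_sum /=.
rewrite -[eqbRHS](mul0r (a%:~R ^+ n)) -[in eqbRHS]qx0 mulrDl mulr_suml addrC.
apply/eqP; congr (_ + _); last by rewrite -mulrzr exprMn.
apply: eq_bigr => i _.
rewrite map_polyZ /= map_polyXn hornerZ hornerXn intrM.
have -> : (p`_i)%:~R = a%:~R * in_alg K q`_i :> K.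
  by rewrite -[LHS](rmorph_int (in_alg K)) pcoef rmorphM rmorph_int.
have -> : (a%:~R : K) ^+ n = a%:~R * (a%:~R ^+ (n.-1 - i) * a%:~R ^+ i).
  rewrite -exprD -exprS; congr (_ ^+ _).
  have n_gt0 : (0 < n)%N by apply: leq_ltn_trans (ltn_ord i).
  by rewrite subnK ?prednK // -ltnS prednK.
rewrite -[x *~ a]mulrzr exprMn -[q`_i *: _]mulr_algl rmorphXn /=.
rewrite -!mulrA.
rewrite [x ^+ i * (a%:~R * _)]mulrCA [RHS]mulrCA.
by rewrite [x ^+ i * (_ * _)]mulrCA.
Qed.
End IntegralScaling.

Lemma integral_rmorph_int (A B : nzRingType) (f : {rmorphism A -> B}) (x : A) :
  integralOver (intr : int -> A) x -> integralOver (intr : int -> B) (f x).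
Proof.
move=> /(integral_rmorph f)[p p_mon rp]; exists p => //.
rewrite -(eq_map_poly (f := f \o (intr : int -> A))) // => a.
by rewrite /= rmorph_int.
Qed.

Lemma integral_sum (A : idomainType) (I : finType) (F : I -> A) :
  (forall i, integralOver (intr : int -> A) (F i)) ->
  integralOver (intr : int -> A) (\sum_i F i).
Proof.
by move=> intF; elim/big_ind: _ => //; [exact: mxpoly.integral0 | exact: integral_add].
Qed.

Section IntegralBasis.
Variable K : fieldExtType rat.
Local Notation d := (\dim {:K}).
Local Notation integral := (integralOver (intr : int -> K)).

Lemma exists_integral_spanning :
  exists b : 'I_d -> K, (forall j, integral (b j)) /\
    forall x, exists c : 'I_d -> rat, x = \sum_j c j *: b j.
Proof.
have /choice[a aP] (j : 'I_d) : exists a : int,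
    a != 0 /\ integral ((vbasis {:K})`_j *~ a).
  by have [a a_neq0 inta] := integral_scaling (vbasis {:K})`_j; exists a.
exists (fun j : 'I_d => (vbasis {:K})`_j *~ a j); split=> [j|x].
  by case: (aP j).
exists (fun j : 'I_d => coord (vbasis {:K}) j x / (a j)%:~R).
rewrite {1}(coord_vbasis (memvf x)); apply: eq_bigr => j _.
rewrite -scaler_int scalerA divfK // intr_eq0.
by case: (aP j).
Qed.

Section Discriminant.
Variables (C : numClosedFieldType) (tau : 'I_d -> {rmorphism K -> C}).

(** The squared determinant is that of the trace matrix (Tr(b_j b_k)), whose entries are rational
    and integral, hence integers. *)
Lemma disc_int b : (forall j, integral (b j)) -> embmx tau b \in unitmx ->
  exists2 D : int, D != 0 & \det (embmx tau b) ^+ 2 = D%:~R.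
Proof.
move=> intb uV; have [c cE] := embmx_coord uV.
pose T x : rat := \tr (\matrix_(j, k) c k (x * b j)).
have TE x : ratr (T x) = \sum_i tau i x.
  apply: (tr_mul_matrix uV) => j; rewrite {1}[x * b j]cE.
  by apply: eq_bigr => k _; rewrite mxE.
have T_int j k : T (b j * b k) \is a Num.int.
  apply: (@rat_integral_int C); rewrite TE.
  by apply: integral_sum => i; apply: integral_rmorph_int; apply: integral_mul.
pose Z : 'M[int]_d := \matrix_(j, k) Num.floor (T (b j * b k)).
have ZE : (embmx tau b)^T *m embmx tau b = map_mx intr Z.
  apply/matrixP => j k; rewrite !mxE -(@ratr_int C) floorK // TE.
  by apply: eq_bigr => i _; rewrite !mxE rmorphM.
have detE : \det (embmx tau b) ^+ 2 = (\det Z)%:~R.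
  by rewrite expr2 -{1}det_tr -det_mulmx ZE det_map_mx.
exists (\det Z) => //; rewrite -(@intr_eq0 C) -detE expf_eq0 /=.
by rewrite -unitfE -unitmxE.
Qed.

(** The replacement is right multiplication by [E], the identity with column [j0] replaced by [c];
    expansion along row [j0] gives its determinant. *)
Lemma det_embmx_replace b (c : 'I_d -> rat) j0 :
  \det (embmx tau (fun j => if j == j0 then \sum_k c k *: b k else b j)) =
  ratr (c j0) * \det (embmx tau b).
Proof.
pose E : 'M[C]_d :=
  \matrix_(k, l) if l == j0 then ratr (c k) else (k == l)%:R.
have -> : embmx tau (fun j => if j == j0 then \sum_k c k *: b k else b j) =
    embmx tau b *m E.
  apply/matrixP => i l; rewrite !mxE; under [RHS]eq_bigr do rewrite !mxE.
  case: eqP => _.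
    by rewrite rmorph_sumZ; apply: eq_bigr => k _; rewrite mulrC.
  rewrite (bigD1 l) //= eqxx mulr1 big1 ?addr0 // => k /negPf ->.
  by rewrite mulr0.
rewrite det_mulmx mulrC; congr (_ * _).
rewrite (expand_det_row E j0) (bigD1 j0) //= big1 ?addr0; last first.
  by move=> l l_neq; rewrite mxE (negPf l_neq) eq_sym (negPf l_neq) mul0r.
rewrite mxE eqxx /cofactor (_ : row' _ _ = 1%:M) ?det1 ?mulr1.
  by rewrite -signr_odd oddD addbb expr0 mulr1.
apply/matrixP => k l; rewrite !mxE eq_sym (negPf (neq_lift _ _)).
by rewrite (inj_eq lift_inj).
Qed.

End Discriminant.

(* Among bases of K made of integers, one whose discriminant is minimal in
   absolute value is integral: otherwise replacing a basis element by an integer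
   whose coordinate there lies in (0, 1) would lower the discriminant. *)
Lemma integral_basis :
  exists w : 'I_d -> K, [/\ forall j, integral (w j),
    forall x, exists c : 'I_d -> rat, x = \sum_j c j *: w j &
    forall x, integral x -> exists c : 'I_d -> int, x = \sum_j w j *~ c j].
Proof.
have [tau [_ [theta tau_inj]]] := exists_embeddings K algC.
pose P n := exists b : 'I_d -> K, [/\ forall j, integral (b j),
  embmx tau b \in unitmx &
  exists2 D : int, `|D|%N = n & \det (embmx tau b) ^+ 2 = D%:~R].
have exP : exists n, `[< P n >].
  have [b [intb spanb]] := exists_integral_spanning.
  have uV := embmx_unit tau_inj spanb.
  have [D D_neq0 DE] := disc_int intb uV.
  by exists `|D|%N; apply/asboolP; exists b; split=> //; exists D.
case: (ex_minnP exP) => n /asboolP[b [intb uV [D Dn DE]]] nmin.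
have [c cE] := embmx_coord uV.
exists b; split=> // [x|x intx]; first by exists (c^~ x).
have D_neq0 : D != 0.
  by rewrite -(@intr_eq0 algC) -DE expf_eq0 /= -unitfE -unitmxE.
suff cint j : c j x \is a Num.int.
  exists (fun j => Num.floor (c j x)); rewrite {1}[x]cE; apply: eq_bigr => j _.
  by rewrite -scaler_int floorK.
apply: contrapT => /negP cNint.
(* Only coordinate [j] is shifted, by its floor: the new element is [x] minus an integer multiple of
   [b j], so it stays integral. *)
pose c' k := c k x - (Num.floor (c j x))%:~R *+ (k == j).
pose b' k := if k == j then \sum_k c' k *: b k else b k.
have cj : c' j = c j x - (Num.floor (c j x))%:~R by rewrite /c' eqxx.
have cj_gt0 : 0 < c' j.
  rewrite cj subr_gt0 lt_neqAle floor_le andbT.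
  by apply: contraNneq cNint => <-; rewrite intr_int.
have cj_lt1 : c' j < 1.
  by rewrite cj ltrBlDl -[X in _ + X](mulr1z 1) -intrD floorD1_gt.
have intb' k : integral (b' k).
  rewrite /b'; case: eqP => // _.
  rewrite (_ : \sum_k _ = x - b j *~ Num.floor (c j x)).
    apply: integral_sub => //; rewrite -mulrzr; apply: integral_mul => //.
    by rewrite -[_%:~R](rmorph_int intr); apply: integral_id.
  rewrite (bigD1 j) //= cj scalerBl scaler_int addrAC; congr (_ - _).
  rewrite [RHS]cE [RHS](bigD1 j) //=; congr (_ + _).
  by apply: eq_bigr => l /negPf l_neq; rewrite /c' l_neq subr0.
have detb' : \det (embmx tau b') = ratr (c' j) * \det (embmx tau b).
  exact: det_embmx_replace.
have uV' : embmx tau b' \in unitmx.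
  rewrite unitmxE detb' unitrM -unitmxE uV andbT unitfE fmorph_eq0.
  by rewrite gt_eqF.
have [D' D'_neq0 D'E] := disc_int intb' uV'.
have /nmin : `[< P `|D'|%N >].
  by apply/asboolP; exists b'; split=> //; exists D'.
apply/negP; rewrite -ltnNge -Dn.
have D'c : D'%:~R = (c' j) ^+ 2 * D%:~R :> rat.
  apply: (fmorph_inj (ratr : {rmorphism rat -> algC})).
  by rewrite /= rmorphM rmorphXn /= !ratr_int -D'E detb' exprMn DE.
rewrite -ltz_nat !abszE -(ltr_int rat) !intr_norm D'c normrM.
rewrite -[X in _ < X]mul1r ltr_pM2r ?normr_gt0 ?intr_eq0 //.
by rewrite ger0_norm ?sqr_ge0 // expr_lt1 // ltW.
Qed.

End IntegralBasis.

(** * Norms of principal ideals *)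

Lemma card_dffun_ord (I : finType) (m : I -> nat) :
  #|{dffun forall i : I, 'I_(m i)}| = (\prod_i m i)%N.
Proof.
rewrite card_dep_ffun foldrE big_image /=.
by apply: eq_bigr => i _; rewrite card_ord.
Qed.

Lemma absz_unit (a : int) : a \is a GRing.unit -> `|a|%N = 1%N.
Proof. by case/orP => /eqP ->. Qed.

Lemma absz_prod (I : finType) (F : I -> int) :
  `|(\prod_i F i)%R|%N = (\prod_i `|F i|)%N.
Proof. by elim/big_rec2: _ => // i m n _ <-; rewrite abszM. Qed.

(** The fibres of [f] are exactly the residue classes modulo [I]. *)
Lemma ideal_norm_card (A : comNzRingType) (I : set A) (T : finType)
    (f : A -> T) :
  (forall t, exists x, f x = t) -> (forall x y, f x = f y <-> I (x - y)) ->
  ideal_norm I = #|T|.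
Proof.
move=> f_surj fI; apply: card_fset_set.
pose g (k : 'I_#|T|) : set A := [set x | f x = enum_val k].
have -> : residue_classes I = g @` setT.
  have class_eq x : [set x + a | a in I] = [set y | f y = f x].
    apply/seteqP; split=> [_ [a aI <-]|y /fI yx] /=.
      by apply/fI; rewrite addrAC subrr add0r.
    by exists (y - x) => //; rewrite addrC subrK.
  apply/seteqP; split=> [_ [x _ <-]|_ [k _ <-]].
    by exists (enum_rank (f x)) => //; rewrite /g enum_rankK class_eq.
  by have [x xk] := f_surj (enum_val k); exists x => //; rewrite class_eq xk.
have g_inj : {in setT &, injective g}.
  move=> k l _ _ gkl; apply: enum_val_inj.
  have [x xk] := f_surj (enum_val k).
  have : g k x by [].
  by rewrite gkl /g /= xk.
by rewrite (card_eql (inj_card_eq g_inj)) card_eq_sym card_II.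
Qed.

(** With the Smith normal form [M = L *m D *m Q], in the coordinates [psi x *m invmx Q] the set [I]
    is cut out by divisibility of coordinate [i] by [e i], so the quotient is a product of cyclic
    groups of orders |e_i|. *)
Lemma ideal_norm_lattice (A : comNzRingType) (I : set A) (n : nat)
    (M : 'M[int]_n) (phi : {additive 'rV[int]_n -> A}) :
  bijective phi -> I = [set phi (c *m M) | c in setT] -> \det M != 0 ->
  ideal_norm I = `|\det M|%N.
Proof.
case=> psi phiK psiK IE.
have [L uL [Q uQ [s _ ME]]] := int_Smith_normal_form M.
pose e (i : 'I_n) : int := s`_i.
pose D : 'M[int]_n := diag_mx (\row_i e i).
have {}ME : M = L *m D *m Q.
  by rewrite ME; congr (_ *m _ *m _); apply/matrixP => i j; rewrite !mxE.
have detM : `|\det M|%N = (\prod_(i < n) `|e i|)%N.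
  rewrite ME !det_mulmx !abszM (absz_unit uL) (absz_unit uQ) mul1n muln1.
  by rewrite det_diag absz_prod; apply: eq_bigr => i _; rewrite mxE.
move=> detM_neq0.
have s_neq0 (i : 'I_n) : e i != 0.
  apply: contra_neq detM_neq0 => si0; apply/eqP; rewrite -absz_eq0 detM.
  by rewrite (bigD1 i) //= si0 mul0n.
have s_gt0 (i : 'I_n) : (0 < `|e i|)%N by rewrite absz_gt0.
pose u x := psi x *m invmx Q.
have uB x y i : u (x - y) ord0 i = u x ord0 i - u y ord0 i.
  have -> : u (x - y) = u x - u y.
    rewrite -[RHS]mulmxBl; congr (_ *m _); apply: (can_inj phiK).
    by rewrite raddfB /= !psiK.
  by rewrite [LHS]mxE; congr (_ + _); rewrite [LHS]mxE.
have inI x : I x <-> forall i, (e i %| u x ord0 i)%Z.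
  rewrite IE; split=> [[c _ <-] i|dv].
    rewrite /u phiK ME !mulmxA mulmxK // mul_mx_diag !mxE.
    exact: dvdz_mull.
  exists (\row_i (u x ord0 i %/ e i)%Z *m invmx L) => //.
  rewrite ME !mulmxA mulmxKV //.
  rewrite -[RHS]psiK -[psi x](mulmxKV uQ) -/(u x); congr (phi (_ *m _)).
  apply/rowP => i; rewrite mul_mx_diag !mxE.
  by move: (dv i); rewrite !mxE => /divzK.
pose r x i : nat := `|(u x ord0 i %% e i)%Z|%N.
have rlt x (i : 'I_n) : (r x i < `|e i|)%N.
  by rewrite -ltz_nat /r gez0_abs ?modz_ge0 // ltz_mod.
pose f x : {dffun forall i : 'I_n, 'I_(`|e i|)} :=
  [ffun i => Ordinal (rlt x i)].
rewrite detM -card_dffun_ord; apply: (@ideal_norm_card _ _ _ f) => [t|x y].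
  exists (phi (\row_i (t i : nat)%:Z *m Q)); apply/ffunP => i; rewrite ffunE.
  apply: val_inj; rewrite /= /r /u phiK mulmxK // mxE -modz_abs modz_nat.
  by rewrite absz_nat modn_small.
rewrite inI; split=> [fE i|dv].
  move/ffunP/(_ i): fE; rewrite !ffunE => /(congr1 val) /= rE.
  rewrite uB -eqz_mod_dvd.
  by move/(congr1 Posz): rE; rewrite /r !gez0_abs ?modz_ge0 // => ->.
apply/ffunP => i; rewrite !ffunE; apply: val_inj => /=; rewrite /r.
by have := dv i; rewrite uB -eqz_mod_dvd => /eqP ->.
Qed.

(** * Principal ideals of the ring of integers *)

Section IdealNorm.
Variable K : fieldExtType rat.
Local Notation d := (\dim {:K}).
Local Notation OK := (ring_of_integers K).

Lemma OK_integral (x : OK) : integralOver (intr : int -> K) (OK_val x).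
Proof. exact/asboolP/OK_valP. Qed.

Lemma OK_val_zmod : zmod_morphism (@OK_val K).
Proof. exact: (raddfB (val : {rmorphism OK -> K})). Qed.

Lemma OK_val_monoid : monoid_morphism (@OK_val K).
Proof.
split; first exact: (rmorph1 (val : {rmorphism OK -> K})).
exact: (rmorphM (val : {rmorphism OK -> K})).
Qed.

HB.instance Definition _ :=
  GRing.isZmodMorphism.Build _ _ (@OK_val K) OK_val_zmod.
HB.instance Definition _ :=
  GRing.isMonoidMorphism.Build _ _ (@OK_val K) OK_val_monoid.

Lemma OK_val_inj : injective (@OK_val K).
Proof. exact: val_inj. Qed.

Lemma OK_mulfI (x : OK) : x != 0 -> injective ( *%R x).
Proof.
move=> x_neq0 y z /(congr1 (@OK_val K)); rewrite !rmorphM => /mulfI yz.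
apply/OK_val_inj/yz; apply: contra_neq x_neq0 => x0.
by apply: OK_val_inj; rewrite x0 rmorph0.
Qed.

Section Combination.
Variable w : 'I_d -> OK.

Definition zcomb (c : 'rV[int]_d) : OK := \sum_j w j *~ c 0 j.

Lemma zcombB : zmod_morphism zcomb.
Proof.
move=> b c; rewrite /zcomb -sumrB; apply: eq_bigr => j _.
by rewrite !mxE mulrzBr.
Qed.

HB.instance Definition _ := GRing.isZmodMorphism.Build _ _ zcomb zcombB.

Lemma zcomb_delta j : zcomb (delta_mx 0 j) = w j.
Proof.
rewrite /zcomb (bigD1 j) //= mxE !eqxx mulr1z big1 ?addr0 // => k /negPf kj.
by rewrite mxE kj andbF mulr0z.
Qed.

End Combination.

Lemma zcomb_embmx w (C : numClosedFieldType)
    (tau : 'I_d -> {rmorphism K -> C}) c i :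
  tau i (OK_val (zcomb w c)) =
  \sum_j embmx tau (fun j => OK_val (w j)) i j * (c 0 j)%:~R.
Proof.
rewrite /zcomb !rmorph_sum; apply: eq_bigr => j _.
by rewrite !mxE !rmorphMz -mulrzr.
Qed.

(** Surjectivity comes from the integral basis, injectivity from the invertibility of its embedding
    matrix. *)
Lemma OK_Zbasis : exists w : 'I_d -> OK, bijective (zcomb w) /\
  forall x : K, exists c : 'I_d -> rat, x = \sum_j c j *: OK_val (w j).
Proof.
have [w [intw spanw Zspanw]] := integral_basis K.
pose v j : OK := @RingOfIntegers K (w j) (asboolT (intw j)).
have vE c : OK_val (zcomb v c) = \sum_j w j *~ c 0 j.
  by rewrite rmorph_sum /=; apply: eq_bigr => j _; rewrite rmorphMz.
exists v; split => //.
have /choice[psi psiE] (x : OK) : exists c, x = zcomb v c.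
  have [c cE] := Zspanw _ (OK_integral x).
  exists (\row_j c j); apply: OK_val_inj; rewrite vE [LHS]cE.
  by apply: eq_bigr => j _; rewrite mxE.
exists psi => // c; suff: injective (zcomb v) by apply; rewrite -psiE.
apply: raddf_inj => {}c c0.
have [tau [_ [theta tau_inj]]] := exists_embeddings K algC.
have uV : embmx tau (fun j => OK_val (v j)) \in unitmx.
  exact: (embmx_unit (b := fun j => OK_val (v j)) tau_inj spanw).
have : embmx tau (fun j => OK_val (v j)) *m (map_mx intr c)^T = 0.
  apply/colP => i; rewrite !mxE -[RHS](rmorph0 (tau i)).
  rewrite -[X in tau i X](rmorph0 (@OK_val K)) -c0 zcomb_embmx.
  by apply: eq_bigr => j _; rewrite !mxE.
move/(congr1 (mulmx (invmx (embmx tau (fun j => OK_val (v j)))))).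
rewrite mulKmx // mulmx0 => /colP c00; apply/rowP => j.
by have /eqP := c00 j; rewrite !mxE intr_eq0 => /eqP.
Qed.

Lemma zcomb_mul w x : bijective (zcomb w) ->
  exists M : 'M[int]_d, forall c, x * zcomb w c = zcomb w (c *m M).
Proof.
case=> psi psiK Kpsi; exists (\matrix_j psi (x * w j)) => c.
rewrite {1}/zcomb mulr_sumr mulmx_sum_row raddf_sum; apply: eq_bigr => j _.
rewrite rowK mulrzAr -[X in X *: _]intz scaler_int raddfMz /=.
by rewrite Kpsi.
Qed.

Section Norm.
Variables (C : numClosedFieldType) (tau : 'I_d -> {rmorphism K -> C}).
Variable theta : K.
Hypothesis tau_inj : injective (fun i => tau i theta).

Lemma det_zcomb_mul w x (M : 'M[int]_d) :
  (forall y : K, exists c : 'I_d -> rat, y = \sum_j c j *: OK_val (w j)) ->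
  (forall c, x * zcomb w c = zcomb w (c *m M)) ->
  (\det M)%:~R = \prod_i tau i (OK_val x).
Proof.
move=> spanw ME.
have uV : embmx tau (fun j => OK_val (w j)) \in unitmx.
  exact: (embmx_unit tau_inj spanw).
rewrite -(det_mul_matrix (M := map_mx intr M) uV).
  by rewrite det_map_mx ratr_int.
move=> j; rewrite -rmorphM -zcomb_delta ME -rowE /zcomb rmorph_sum /=.
by apply: eq_bigr => k _; rewrite !mxE rmorphMz scaler_int.
Qed.

Lemma prod_rmorph_neq0 (x : OK) : x != 0 -> \prod_i tau i (OK_val x) != 0.
Proof.
move=> x_neq0; apply/prodf_neq0 => i _; rewrite fmorph_eq0.
by apply: contra_neq x_neq0 => x0; apply: OK_val_inj; rewrite x0 rmorph0.
Qed.

(** In a Z-basis the ideal is the image of the matrix of multiplication by [x], so its index is the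
    absolute value of the determinant, and the determinant is the product of the conjugates. *)
Lemma ideal_normE (x : OK) : x != 0 ->
  (ideal_norm (ideal_gen x))%:R = \prod_i `|tau i (OK_val x)|.
Proof.
move=> x_neq0; have [w [bijw spanw]] := OK_Zbasis.
have [M ME] := zcomb_mul x bijw.
have detM := det_zcomb_mul spanw ME.
rewrite (@ideal_norm_lattice _ _ _ M (zcomb w : {additive _ -> _})) //.
- by rewrite -normr_prod -detM -intr_norm -abszE.
- case: bijw => psi psiK Kpsi; apply/seteqP; split=> [_ [y _ <-]|_ [c _ <-]] /=.
    by exists (psi y) => //; rewrite -ME Kpsi.
  by exists (zcomb w c) => //; rewrite ME.
- by rewrite -(@intr_eq0 C) detM prod_rmorph_neq0.
Qed.

End Norm.

(** The adjugate of the multiplication matrix exhibits its determinant as a multiple of [x]; a sign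
    then turns the determinant into the norm. *)
Lemma ideal_norm_in (x : OK) : x != 0 ->
  (0 < ideal_norm (ideal_gen x))%N /\
  ideal_gen x (ideal_norm (ideal_gen x))%:R.
Proof.
move=> x_neq0; have [w [bijw spanw]] := OK_Zbasis.
have [tau [_ [theta tau_inj]]] := exists_embeddings K algC.
have [M ME] := zcomb_mul x bijw.
have detM := det_zcomb_mul tau_inj spanw ME.
have normE : ideal_norm (ideal_gen x) = `|\det M|%N.
  apply/eqP; rewrite -(eqr_nat algC) (ideal_normE tau_inj x_neq0).
  by rewrite -normr_prod -detM -intr_norm -abszE.
have detM_neq0 : \det M != 0.
  by rewrite -(@intr_eq0 algC) detM prod_rmorph_neq0.
split; first by rewrite normE absz_gt0.
have [psi psiK Kpsi] := bijw.
have xdet : x * zcomb w (psi 1 *m \adj M) = (\det M)%:~R.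
  rewrite ME -mulmxA mul_adj_mx mul_mx_scalar.
  rewrite -[X in X *: _]intz scaler_int raddfMz /=.
  by rewrite Kpsi.
exists (zcomb w (psi 1 *m \adj M) * (-1) ^+ (\det M < 0)%R) => //.
rewrite mulrA xdet normE.
by rewrite [RHS]pmulrn abszE normrEsign rmorphM /= rmorph_sign mulrC.
Qed.

(* An ideal containing m is a union of residue classes modulo m. *)
Lemma finite_ideals_containing (m : nat) : (0 < m)%N ->
  finite_set [set I : set OK | is_principal I /\ I m%:R].
Proof.
move=> m_gt0; have [w [[psi psiK Kpsi] spanw]] := OK_Zbasis.
pose T := {ffun 'I_d -> 'I_m}.
have rlt x (j : 'I_d) : (`|(psi x 0%R j %% m)%Z|%N < m)%N.
  by rewrite -ltz_nat gez0_abs ?modz_ge0 ?ltz_mod // -lt0n.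
pose r x : T := [ffun j => Ordinal (rlt x j)].
have rP x y : r x = r y -> exists z, x - y = m%:R * z.
  move=> rxy; have dv j : (m %| psi x 0%R j - psi y 0%R j)%Z.
    move/ffunP/(_ j): rxy; rewrite !ffunE => /(congr1 val) /=.
    move/(congr1 Posz); rewrite !gez0_abs ?modz_ge0 -?lt0n // => /eqP.
    by rewrite eqz_mod_dvd.
  exists (zcomb w (\row_j ((psi x 0%R j - psi y 0%R j) %/ m)%Z)).
  rewrite mulr_natl -raddfMn -[x]Kpsi -[y]Kpsi -raddfB !psiK; congr zcomb.
  apply/rowP => j; rewrite mulmxnE !mxE; move/divzK: (dv j) => {1}<-.
  by rewrite -mulr_natr natz.
pose g (S : {set T}) : set OK := [set x | r x \in S].
apply: (@sub_finite_set _ _ (g @` setT)); last exact: finite_image.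
move=> I [[x ->] [u _ xu]].
exists [set t | `[< exists2 y, ideal_gen x y & r y = t >]]%SET => //.
apply/seteqP; split=> y; rewrite /g /= ?inE; last first.
  by move=> xy; exists y.
move=> [_ [z _ <-] /esym /rP[v yv]].
exists (u * v + z) => //.
by rewrite mulrDr mulrA xu -yv subrK.
Qed.

(** Each such norm lies in its ideal and divides the factorial of [B], so all these ideals contain
    that one positive integer. *)
Lemma finite_ideals_norm_le (B : nat) :
  finite_set [set I : set OK |
    exists2 x, I = ideal_gen x & x != 0 /\ (ideal_norm I <= B)%N].
Proof.
apply: sub_finite_set (finite_ideals_containing (fact_gt0 B)).
move=> I [x -> [x_neq0 leB]]; split; first by exists x.
have [N_gt0 [u _ xu]] := ideal_norm_in x_neq0.
have /dvdnP[k ->] : (ideal_norm (ideal_gen x) %| B`!)%N.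
  by rewrite dvdn_fact // N_gt0.
by exists (u * k%:R) => //; rewrite mulrA xu -natrM mulnC.
Qed.

End IdealNorm.

(** * Units with prescribed absolute values *)

Lemma pigeonhole (T : finType) n (m : 'I_n -> nat) (f : T -> 'I_n -> nat) :
  (forall t i, f t i < m i)%N -> (\prod_i m i < #|T|)%N ->
  exists t t', t != t' /\ f t =1 f t'.
Proof.
move=> f_lt lt_T.
pose g t : {dffun forall i : 'I_n, 'I_(m i)} := [ffun i => Ordinal (f_lt t i)].
have /injectivePn[t [t' t_neq gtt']] : ~~ injectiveb g.
  by apply/injectiveP => /leq_card; rewrite card_dffun_ord leqNgt lt_T.
exists t, t'; split=> [//|i].
by move/ffunP/(_ i): gtt'; rewrite !ffunE => /(congr1 val).
Qed.

Lemma finite_set_ubound (R : realType) (T : Type) (S : set T) (F : T -> R) :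
  finite_set S -> exists2 B, 0 < B & forall x, S x -> F x <= B.
Proof.
move=> /(finite_image F)/finite_seqP[s sE].
exists (1 + \sum_(y <- s) `|y|).
  by rewrite ltr_pwDl ?ltr01 // sumr_ge0.
move=> x Sx; have : F x \in s.
  by have : [set` s] (F x) by rewrite -sE; exists x.
elim: s {sE} => // y s IH; rewrite inE big_cons addrCA => /orP[/eqP ->|/IH le].
  rewrite (le_trans (ler_norm _)) // lerDl addr_ge0 //.
  by rewrite sumr_ge0.
by rewrite (le_trans le) // lerDr.
Qed.

(* Minkowski's theorem on linear forms, with a constant C independent of t; the
   box principle applied to the vectors with coordinates in [0, M] suffices once
   M is large compared with the t i. *)
Lemma linear_forms_bound (R : realType) n (A : 'M[R]_n) : (0 < n)%N ->
  exists2 C : R, 0 < C & forall t : 'I_n -> R, (forall i, 0 < t i) ->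
    \prod_i t i = 1 -> exists2 c : 'rV[int]_n, c != 0 &
    forall i, `|\sum_j A i j * (c 0 j)%:~R| <= C * t i.
Proof.
move=> n_gt0; pose B := 1 + \sum_i \sum_j `|A i j|.
have B_gt0 : 0 < B.
  by rewrite ltr_pwDl ?ltr01 //; do ?[apply: sumr_ge0 => ? _].
have rowB i : \sum_j `|A i j| <= B.
  rewrite /B [X in _ <= _ + X](bigD1 i) //= addrCA lerDl addr_ge0 //.
  rewrite sumr_ge0 // => k _.
  exact: sumr_ge0.
exists (4 * B) => [|t t_gt0 prod_t]; first by rewrite mulr_gt0.
(* [M] is at least every [2 * t i], so that rounding up a cell count is absorbed: M/(2 t_i) + 1 <=
   M/t_i. *)
pose M := (Num.truncn (\sum_i 2 * t i)).+1.
have M_ge i : 2 * t i <= M%:R.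
  apply: le_trans (ltW (truncnS_gt _)).
  rewrite (bigD1 i) //= lerDl sumr_ge0 // => k _.
  by rewrite mulr_ge0 // ltW.
have Ct_gt0 i : 0 < 4 * B * t i by rewrite !mulr_gt0.
pose L (c : {ffun 'I_n -> 'I_M.+1}) i : R := \sum_j A i j * (c j)%:R.
have LB c i : `|L c i| <= M%:R * B.
  apply: le_trans (ler_norm_sum _ _ _) _.
  apply: le_trans (ler_wpM2l _ (rowB i)); last by rewrite ler0n.
  rewrite mulr_sumr; apply: ler_sum => j _; rewrite normrM mulrC normr_nat.
  by rewrite ler_wpM2r // ler_nat -ltnS.
(* The form [L c i] is measured from its lower bound -MB in cells of width 4 B t_i, so that [z c i]
   is at most M/(2 t_i). *)
pose z c i := (L c i + M%:R * B) / (4 * B * t i).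
have z_ge0 c i : 0 <= z c i.
  rewrite divr_ge0 ?(ltW (Ct_gt0 i)) // -lerBlDr sub0r.
  by have := LB c i; rewrite ler_norml => /andP[].
pose m i := (Num.truncn (M%:R / (2 * t i) : R)).+1.
have z_le c i : z c i <= M%:R / (2 * t i).
  rewrite ler_pdivrMr // (_ : _ / _ * _ = M%:R * B + M%:R * B).
    by rewrite lerD2r; have := LB c i; rewrite ler_norml => /andP[].
  by field; rewrite gt_eqF.
have f_lt c i : (Num.truncn (z c i) < m i)%N by rewrite ltnS le_truncn.
have m_le i : (m i)%:R <= M%:R / t i.
  have t2_gt0 : 0 < 2 * t i by rewrite mulr_gt0.
  rewrite /m -natr1 (@le_trans _ _ (M%:R / (2 * t i) + M%:R / (2 * t i))) //.
    apply: lerD; first by rewrite truncn_le divr_ge0 // ltW.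
    by rewrite ler_pdivlMr // mul1r.
  by rewrite le_eqVlt; apply/orP; left; apply/eqP; field; rewrite gt_eqF.
(* As the [t i] have product 1, there are at most M^n boxes for (M+1)^n vectors. *)
have lt_card : (\prod_i m i < #|{ffun 'I_n -> 'I_M.+1}|)%N.
  rewrite card_ffun !card_ord -(ltr_nat R) natr_prod.
  apply: (@le_lt_trans _ _ (\prod_(i < n) (M%:R / t i))).
    by apply: ler_prod => i _; rewrite ler0n m_le.
  rewrite big_split /=.
  rewrite prodfV prod_t invr1 mulr1 prodr_const card_ord -natrX ltr_nat.
  by rewrite ltn_exp2r.
have [c [c' [c_neq zE]]] := pigeonhole f_lt lt_card.
exists (\row_j ((c j : nat)%:Z - (c' j : nat)%:Z)).
  apply: contraNneq c_neq => /rowP cc'; apply/eqP/ffunP => j; apply: val_inj.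
  by have /eqP := cc' j; rewrite !mxE subr_eq0 => /eqP [].
move=> i; rewrite (_ : \sum_j _ = L c i - L c' i); last first.
  rewrite -sumrB; apply: eq_bigr => j _.
  by rewrite !mxE intrB mulrBr.
(* Equal truncations put the two values of [z] within distance 1, so the forms differ by at most one
   cell width. *)
have /andP[z1 z2] := truncn_itv (z_ge0 c i).
have /andP[z3 z4] := truncn_itv (z_ge0 c' i).
rewrite -zE in z3 z4.
have -> : L c i - L c' i = (z c i - z c' i) * (4 * B * t i).
  by rewrite /z -mulrBl divfK ?gt_eqF // opprD addrACA subrr addr0.
rewrite normrM (gtr0_norm (Ct_gt0 i)) -[leRHS]mul1r ler_pM2r //.
rewrite -natr1 in z2 z4.
by rewrite ler_norml; apply/andP; split; lra.
Qed.

Section Units.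
Variables (R : realType) (K : fieldExtType rat).
Local Notation d := (\dim {:K}).
Local Notation OK := (ring_of_integers K).
Variable tau : 'I_d -> {rmorphism K -> R[i]}.
Hypothesis tau_all :
  forall sigma : {rmorphism K -> R[i]}, exists i, sigma =1 tau i.
Hypothesis tau_inj : exists theta, injective (fun i => tau i theta).

Definition conj_sym (t : 'I_d -> R) :=
  forall i j, (forall x, tau j x = conjc (tau i x)) -> t i = t j.

Lemma conj_embedding i : exists j, forall x, tau j x = conjc (tau i x).
Proof.
have [j jE] := tau_all (conjc \o tau i).
by exists j => x; rewrite -jE.
Qed.

Lemma dim_gt0 : (0 < d)%N.
Proof. by rewrite (adim_gt0 {:K}%AS). Qed.

Lemma cmodE (z : R[i]) : `|z| = (cmod z)%:C%C.
Proof. by []. Qed.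

Lemma cmod_le (z : R[i]) : cmod z <= `|complex.Re z| + `|complex.Im z|.
Proof.
case: z => a b /=; rewrite /cmod /=.
have ab_ge0 : 0 <= `|a| + `|b| by rewrite addr_ge0.
rewrite -(ger0_norm ab_ge0) -sqrtr_sqr ler_wsqrtr //.
rewrite sqrrD !real_normK ?num_real //.
by rewrite addrAC lerDl mulrn_wge0 // mulr_ge0.
Qed.

Lemma cmod_ge0 (z : R[i]) : 0 <= cmod z.
Proof. by case: z => a b; apply: sqrtr_ge0. Qed.

Lemma cmodM (x y : R[i]) : cmod (x * y) = cmod x * cmod y.
Proof. exact: Normc.normcM. Qed.

Lemma cmod_rmorph_gt0 (sigma : {rmorphism K -> R[i]}) (x : OK) :
  x != 0 -> 0 < cmod (sigma (OK_val x)).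
Proof.
move=> x_neq0; rewrite lt_neqAle cmod_ge0 andbT eq_sym.
apply: contra_neq x_neq0 => /Normc.eq0_normc/eqP; rewrite fmorph_eq0 => /eqP x0.
by apply: OK_val_inj; rewrite x0 rmorph0.
Qed.

Lemma cmod_conjc (z : R[i]) : cmod (conjc z) = cmod z.
Proof. by case: z => a b; rewrite /cmod /= sqrrN. Qed.

Lemma ideal_norm_cmod (x : OK) : x != 0 ->
  (ideal_norm (ideal_gen x))%:R = \prod_i cmod (tau i (OK_val x)).
Proof.
move=> x_neq0; have [theta inj] := tau_inj.
apply: (@complexI R); rewrite /= rmorph_nat (ideal_normE inj x_neq0).
by rewrite rmorph_prod; apply: eq_bigr => i _; rewrite cmodE.
Qed.

Lemma small_integer : exists2 C : R, 0 < C & forall t, conj_sym t ->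
  (forall i, 0 < t i) -> \prod_i t i = 1 ->
  exists2 a : OK, a != 0 & forall i, cmod (tau i (OK_val a)) <= C * t i.
Proof.
have [w [bijw _]] := OK_Zbasis K.
(* For conjugate embeddings tau i and tau j, the forms y i = Re + Im and
   y j = Re - Im together bound both Re and Im, so real and non-real embeddings
   can be treated alike. *)
pose y i (x : OK) : R :=
  complex.Re (tau i (OK_val x)) + complex.Im (tau i (OK_val x)).
have [C C_gt0 CP] := linear_forms_bound (\matrix_(i, j) y i (w j)) dim_gt0.
exists (2 * C) => [|t t_sym t_gt0 prod_t]; first by rewrite mulr_gt0.
have [c c_neq0 cP] := CP t t_gt0 prod_t.
exists (zcomb w c) => [|i].
  by rewrite -(raddf0 (zcomb w)) (inj_eq (bij_inj bijw)).
have yB k : `|y k (zcomb w c)| <= C * t k.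
  rewrite (_ : y k _ = \sum_j (\matrix_(i, j) y i (w j)) k j * (c 0 j)%:~R) //.
  rewrite /y /zcomb !raddf_sum -big_split; apply: eq_bigr => j _ /=.
  by rewrite mxE !raddfMz /= -mulrzDl mulrzr.
have [j jE] := conj_embedding i.
have := yB j; rewrite -(t_sym i j jE).
have := yB i; rewrite /y jE.
have := cmod_le (tau i (OK_val (zcomb w c))).
case: (tau i _) => a b /= ab.
move=> h1 h2; rewrite (le_trans ab) //.
have : `|a| <= C * t i /\ `|b| <= C * t i.
  move: h1 h2; rewrite !ler_norml => /andP[? ?] /andP[? ?].
  by split; apply/andP; split; lra.
by case=> *; lra.
Qed.

Lemma units_cobounded : exists2 C : R, 0 < C & forall t, conj_sym t ->
  (forall i, 0 < t i) -> \prod_i t i = 1 ->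
  exists2 u : OK, is_OK_unit u & forall i, cmod (tau i (OK_val u)) <= C * t i.
Proof.
have [C C_gt0 CP] := small_integer.
pose B := Num.truncn (C ^+ d).
pose S := [set I : set OK |
  exists2 x, I = ideal_gen x & x != 0 /\ (ideal_norm I <= B)%N].
(* A generator is fixed for each ideal of norm at most [B]; 0 is a default elsewhere. *)
have /choice[g gP] (I : set OK) : exists x, S I -> I = ideal_gen x /\ x != 0.
  have [[x IE [x_neq0 _]]|nSI] := pselect (S I); first by exists x.
  by exists 0.
(* Only finitely many generators matter, so the inverses of the absolute values of their conjugates
   have a common bound. *)
have [C' C'_gt0 C'P] := finite_set_ubound
  (fun I => \sum_i (cmod (tau i (OK_val (g I))))^-1)
  (finite_ideals_norm_le K B).
exists (C * C') => [|t t_sym t_gt0 prod_t]; first by rewrite mulr_gt0.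
have [a a_neq0 aP] := CP t t_sym t_gt0 prod_t.
have SI : S (ideal_gen a).
  exists a => //; split=> //; rewrite truncn_ge_nat ?exprn_ge0 ?(ltW C_gt0) //.
  rewrite ideal_norm_cmod // (@le_trans _ _ (\prod_i (C * t i))) //.
    by apply: ler_prod => i _; rewrite cmod_ge0 aP.
  by rewrite big_split /= prod_t mulr1 prodr_const card_ord.
have [IE gI_neq0] := gP _ SI; have gC := C'P _ SI.
set b := g _ in IE gI_neq0 gC.
(* Both [a] and [b] generate the same ideal, so a = b u with u a unit, and |tau(u)| = |tau(a)| /
   |tau(b)| <= C C' t(tau). *)
have [u _ bu] : ideal_gen b a by rewrite -IE; exists 1; rewrite ?mulr1.
have [v _ av] : ideal_gen a b by rewrite IE; exists 1; rewrite ?mulr1.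
exists u => [|i].
  by exists v; apply: (OK_mulfI gI_neq0); rewrite mulrA bu av mulr1.
have bi_gt0 := cmod_rmorph_gt0 (tau i) gI_neq0.
rewrite -(ler_pM2l bi_gt0) -cmodM -rmorphM -rmorphM bu (le_trans (aP i)) //.
rewrite [leRHS]mulrC -!mulrA ler_pM2l // mulrCA -[leLHS]mulr1 ler_pM2l //.
rewrite -ler_pdivrMr // div1r; apply: le_trans gC.
rewrite (bigD1 i) //= lerDl sumr_ge0 // => k _.
by rewrite invr_ge0 cmod_ge0.
Qed.

End Units.

(** * Strictly large ideals *)

Lemma ideal_gen_mul_unit (A : comNzRingType) (x u v : A) :
  u * v = 1 -> ideal_gen (x * u) = ideal_gen x.
Proof.
move=> uv; apply/seteqP; split=> _ [y _ <-].
  by exists (u * y); rewrite ?mulrA.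
by exists (v * y) => //; rewrite -!mulrA [u * _]mulrA uv mul1r.
Qed.

Lemma mx_norm_entry (R : realType) n (v : 'rV[R]_n) k : `|v 0 k| <= `|v|.
Proof.
rewrite [leRHS]mx_normrE.
exact: (le_bigmax 0 (fun ij : 'I_1 * 'I_n => `|v ij.1 ij.2|) (0, k)).
Qed.

Section LargeNorm.
Variables (R : realType) (K : fieldExtType rat).
Local Notation d := (\dim {:K}).
Local Notation OK := (ring_of_integers K).

Lemma large_norm_strictly_large : exists B : nat, forall a : OK, a != 0 ->
  (B < ideal_norm (ideal_gen a))%N -> strictly_large R (ideal_gen a).
Proof.
have [tau [tau_all tau_inj]] := exists_embeddings K R[i].
have [C C_gt0 CP] := units_cobounded tau_all tau_inj.
(* A norm above C^d makes its d-th root [nu] exceed [C]. The unit [u] for the weights |tau(a)| / nu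
   then has |tau(u)| < |tau(a)|, so a/u = [a * v] is strictly large. *)
exists (Num.truncn (C ^+ d)) => a a_neq0 N_gt.
set N := ideal_norm _ in N_gt.
have N_gt0 : 0 < N%:R :> R by rewrite ltr0n; case: (ideal_norm_in a_neq0).
have d_gt0 : 0 < d%:R :> R by rewrite ltr0n dim_gt0.
pose nu : R := expR (ln N%:R / d%:R).
have nu_gt0 : 0 < nu by apply: expR_gt0.
have nud : nu ^+ d = N%:R.
  by rewrite -expRM_natl mulrC divfK ?gt_eqF // lnK.
have nu_gtC : C < nu.
  rewrite -(ltr_pXn2r (dim_gt0 K)) ?nnegrE ?ltW // nud.
  by apply: lt_le_trans (truncnS_gt _) _; rewrite ler_nat.
have [|i||u [v uv] uP] := CP (fun i => cmod (tau i (OK_val a)) / nu).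
- move=> i j ij; congr (_ / _); rewrite ij; exact/esym/cmod_conjc.
- by rewrite divr_gt0 // cmod_rmorph_gt0.
- rewrite big_split /= prodr_const card_ord -ideal_norm_cmod // -/N.
  by rewrite exprVn nud divff ?gt_eqF.
exists (a * v); split.
  by rewrite (ideal_gen_mul_unit a (v := u)) // mulrC.
move=> sigma; have [i iE] := tau_all sigma.
rewrite iE !rmorphM cmodM.
have u_neq0 : u != 0.
  by apply: contra_eq_neq uv => ->; rewrite mul0r eq_sym oner_eq0.
have u_gt0 := cmod_rmorph_gt0 (tau i) u_neq0.
rewrite -(ltr_pM2l u_gt0) mulr1 mulrCA -cmodM -rmorphM -rmorphM uv !rmorph1.
have -> : cmod (1 : R[i]) = 1 by apply: Normc.normc1.
rewrite mulr1 (le_lt_trans (uP i)) // mulrCA gtr_pMr ?cmod_rmorph_gt0 //.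
by rewrite ltr_pdivrMr // mul1r.
Qed.

(** The zero ideal is outside the scope of the norm bound and is added to the finitely many nonzero
    ideals of small norm. *)
Lemma finite_not_strictly_large :
  finite_set [set A : set OK | is_principal A /\ ~ strictly_large R A].
Proof.
have [B BP] := large_norm_strictly_large.
apply: (@sub_finite_set _ _ ([set ideal_gen 0] `|` [set I : set OK |
    exists2 x, I = ideal_gen x & x != 0 /\ (ideal_norm I <= B)%N])).
  move=> _ [[x ->] Nlarge]; have [->|x_neq0] := eqVneq x 0; first by left.
  right; exists x => //; split=> //; rewrite leqNgt; apply/negP => /BP.
  by move/(_ x_neq0).
rewrite finite_setU; split; first exact: finite_set1.
exact: finite_ideals_norm_le.
Qed.

End LargeNorm.

(** * Places and the logarithmic embedding *)

Section Places.
Variables (R : realType) (K : fieldExtType rat) (r1 r2 : nat).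
Local Notation d := (\dim {:K}).
Local Notation OK := (ring_of_integers K).
Variable sigma : 'I_(r1 + r2) -> {rmorphism K -> R[i]}.
Hypothesis sigma_places : is_place_enum sigma.

Definition above (tau : {rmorphism K -> R[i]}) k :=
  tau =1 sigma k \/ tau =1 (fun x => conjc (sigma k x)).

(** The local degree of the place [k]. *)
Definition place_mult (k : 'I_(r1 + r2)) : nat :=
  if (k < r1)%N then 1%N else 2%N.

Lemma above_inj tau k l : above tau k -> above tau l -> k = l.
Proof.
have [m [_ mP]] := place_exhaustive sigma_places tau.
by move=> /mP <- /mP <-.
Qed.

Lemma cmod_above tau k : above tau k ->
  forall x, cmod (tau x) = cmod (sigma k x).
Proof. by case=> tauE x; rewrite tauE ?cmod_conjc. Qed.

Lemma log_embeddingE x k :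
  log_embedding sigma x 0 k = (place_mult k)%:R * ln (cmod (sigma k x)).
Proof.
rewrite /place_mult; case: (split_ordP k) => j ->.
  by rewrite row_mxEl mxE mul1r.
by rewrite row_mxEr mxE.
Qed.

Variable tau : 'I_d -> {rmorphism K -> R[i]}.
Hypothesis tau_all :
  forall rho : {rmorphism K -> R[i]}, exists i, rho =1 tau i.
Hypothesis tau_inj : exists theta, injective (fun i => tau i theta).

Lemma tau_eq1 i j : tau i =1 tau j -> i = j.
Proof. by move=> eq_ij; have [theta inj] := tau_inj; apply: inj. Qed.

Variable f : 'I_d -> 'I_(r1 + r2).
Hypothesis fP : forall i, above (tau i) (f i).

(** Only [sigma k] and its conjugate lie above [k]; they coincide at a real place and differ at a
    non-real one. *)
Lemma card_above k : #|[pred i | f i == k]| = place_mult k.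
Proof.
have [i iE] := tau_all (sigma k).
have fi : f i = k by apply: above_inj (fP i) _; left=> x; rewrite iE.
rewrite /place_mult; case: (split_ordP k) => [l kE|l kE] in i iE fi *.
  rewrite -[RHS](card1 i); apply/eq_card => j.
  apply/eqP/eqP => [fj|-> //]; apply: tau_eq1 => x.
  have real y : complex.Im (sigma k y) = 0.
    by rewrite kE; exact: place_real sigma_places _ _.
  rewrite -iE; have := fP j; rewrite fj => -[-> //|->].
  by move: (real x); case: (sigma k x) => a b /= ->; rewrite oppr0.
have [i' i'E] := tau_all (conjc \o sigma k).
have fi' : f i' = k.
  by apply: above_inj (fP i') _; right=> x; rewrite -i'E.
have i_neq : i != i'.
  have [x] := place_nonreal sigma_places l; rewrite -kE => nonreal.
  apply/eqP => ii'; apply: nonreal; have := iE x.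
  rewrite ii' -i'E /=; case: (sigma k x) => a b /= [] bN.
  by apply/eqP; move/eqP: bN; rewrite -subr_eq0 opprK -mulr2n mulrn_eq0.
have <- : #|pred2 i i'| = 2%N by rewrite card2 i_neq.
apply/eq_card => j; apply/eqP/orP => [fj|[] /eqP -> //].
have := fP j; rewrite fj => -[] jE; [left|right]; apply/eqP/tau_eq1 => x.
  by rewrite jE iE.
by rewrite jE -i'E.
Qed.

Lemma sum_above (G : 'I_(r1 + r2) -> R) :
  \sum_i G (f i) = \sum_k (place_mult k)%:R * G k.
Proof.
rewrite (partition_big f predT) //=; apply: eq_bigr => k _.
rewrite (eq_bigr (fun=> G k)) => [|i /eqP -> //].
by rewrite sumr_const -card_above mulr_natl.
Qed.

Lemma f_surj k : exists i, f i = k.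
Proof.
have [i iE] := tau_all (sigma k); exists i.
by apply: above_inj (fP i) _; left=> x; rewrite iE.
Qed.

(** The factor 2 at non-real places accounts for both conjugate embeddings, so the sum is the
    logarithm of the norm as a product over all embeddings. *)
Lemma sum_log_embedding (x : OK) : x != 0 ->
  \sum_k log_embedding sigma (OK_val x) 0 k =
  ln (ideal_norm (ideal_gen x))%:R.
Proof.
move=> x_neq0; under eq_bigr do rewrite log_embeddingE.
rewrite -(sum_above (fun k => ln (cmod (sigma k (OK_val x))))).
rewrite (ideal_norm_cmod tau_inj x_neq0).
apply: expR_inj; rewrite lnK; last first.
  by rewrite posrE; apply: prodr_gt0 => i _; apply: cmod_rmorph_gt0.
rewrite expR_sum; apply: eq_bigr => i _.
by rewrite lnK -(cmod_above (fP i)) // posrE cmod_rmorph_gt0.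
Qed.

Lemma conj_above i j : (forall x, tau j x = conjc (tau i x)) -> f i = f j.
Proof.
move=> jE; apply: (@above_inj (tau j)) (fP j).
case: (fP i) => iE; [right|left] => x; rewrite jE iE //.
exact: conjcK.
Qed.

(** The weights exp(v_k / e_k) give a unit whose logarithmic embedding exceeds [v] by at most a
    constant in each coordinate; the coordinate sum makes this bound two-sided. *)
Lemma log_embedding_unit_close : exists C : R,
  forall v : 'rV[R]_(r1 + r2), \sum_k v 0 k = 0 ->
  exists2 u : OK, is_OK_unit u &
    forall k, `|(v - log_embedding sigma (OK_val u)) 0 k| <= C.
Proof.
have [C C_gt0 CP] := units_cobounded tau_all tau_inj.
pose D := 2 * `|ln C|.
have D_ge0 : 0 <= D by rewrite mulr_ge0.
exists ((r1 + r2)%:R * D + D) => v sumv.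
pose e k : R := (place_mult k)%:R.
have e_gt0 k : 0 < e k by rewrite ltr0n /place_mult; case: ifP.
have e_le2 k : e k <= 2 by rewrite ler_nat /place_mult; case: ifP.
have [|i||u uu uP] := CP (fun i => expR (v 0 (f i) / e (f i))).
- by move=> i j /conj_above ->.
- by apply: expR_gt0.
- rewrite -expR_sum (sum_above (fun k => v 0 k / e k)).
  rewrite (eq_bigr (v 0)) ?sumv ?expR0 // => k _.
  by rewrite mulrC divfK // gt_eqF.
exists u => //.
have u_neq0 : u != 0.
  case: uu => u' uu'.
  by apply: contra_eq_neq uu' => ->; rewrite mul0r eq_sym oner_eq0.
set y := v - _.
have yE k : y 0 k = v 0 k - log_embedding sigma (OK_val u) 0 k by rewrite !mxE.
(* This is the logarithm of |sigma_k(u)| <= C exp(v_k / e_k), multiplied by e_k <= 2. *)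
have y_ge k : - D <= y 0 k.
  rewrite yE log_embeddingE -/(e k).
  have [i ik] := f_surj k; have := uP i; rewrite ik (cmod_above (fP i)) ik.
  rewrite -ler_ln ?posrE ?mulr_gt0 ?expR_gt0 ?cmod_rmorph_gt0 //.
  rewrite lnM ?posrE ?expR_gt0 // expRK => le.
  have := ler_wpM2l (ltW (e_gt0 k)) le.
  rewrite mulrDr [_ * (_ / _)]mulrC divfK ?gt_eqF //.
  have : e k * ln C <= D.
    by rewrite (le_trans (ler_wpM2l (ltW (e_gt0 k)) (ler_norm _))) // ler_wpM2r.
  by lra.
have sumy : \sum_k y 0 k <= 0.
  under eq_bigr do rewrite yE.
  rewrite sumrB sumv sum_log_embedding // sub0r oppr_le0 ln_ge0 // ler1n.
  by case: (ideal_norm_in u_neq0).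
move=> k; rewrite ler_norml; apply/andP; split.
  by rewrite (le_trans _ (y_ge k)) // lerN2 lerDr mulr_ge0.
(* The other coordinates are at least -D and the total is at most 0, which bounds y_k above by (r1 +
   r2) D. *)
have : \sum_(l | l != k) - D <= \sum_(l | l != k) y 0 l.
  by apply: ler_sum.
move: sumy; rewrite (bigD1 k) //=.
have : - ((r1 + r2)%:R * D) <= \sum_(l < r1 + r2 | l != k) - D.
  rewrite sumrN lerN2 [leRHS](_ : _ = \sum_(l < r1 + r2) D).
    by rewrite [leRHS](bigD1 k) //= lerDr.
  by rewrite sumr_const card_ord mulr_natl.
by lra.
Qed.

End Places.

(** Finitely many vectors of [L] with span of maximal dimension span all of [L]. Modulo this span
    the multiples [v *+ m] stay bounded, so [v] is zero there. *)
Lemma span_of_bounded_distance (R : realType) n (L : set 'rV[R]_n)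
    (v : 'rV[R]_n) (C : R) :
  (forall m : nat, exists2 w, L w & forall k, `|(v *+ m - w) 0 k| <= C) ->
  exists2 X : seq 'rV[R]_n, (forall w, w \in X -> L w) & v \in <<X>>%VS.
Proof.
move=> close.
pose P k := exists X : seq 'rV[R]_n,
  (forall w, w \in X -> L w) /\ \dim <<X>> = k.
have exP : exists k, `[< P k >].
  by exists (\dim <<[::] : seq 'rV[R]_n>>); apply/asboolP; exists [::].
have ubP k : `[< P k >] -> (k <= \dim {:'rV[R]_n})%N.
  by move=> /asboolP[X [_ <-]]; apply: dimvS; apply: subvf.
case: (ex_maxnP exP ubP) => k /asboolP[X [XL dimX]] kmax.
exists X => //.
have LX w : L w -> w \in <<X>>%VS.
  move=> Lw; have : (\dim <<w :: X>> <= \dim <<X>>)%N.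
    rewrite dimX; apply: kmax; apply/asboolP; exists (w :: X); split=> // u.
    by rewrite inE => /orP[/eqP ->|/XL].
  move=> le_dim; have /eqP -> : <<X>>%VS == <<w :: X>>%VS.
    by rewrite eqEdim le_dim span_cons addvSr.
  by apply: memv_span; rewrite inE eqxx.
pose g y : 'rV[R]_n := y - projv <<X>>%VS y.
(* g is linear, kills L and measures the distance to the span of X. *)
have gB y w : L w -> g (y - w) = g y.
  by move=> /LX Xw; rewrite /g raddfB /= (projv_id Xw) opprB addrA addrNK.
have gE y : g y = \sum_k y 0 k *: g (delta_mx 0 k).
  rewrite {1}/g {1 2}[y]row_sum_delta linear_sum -sumrB; apply: eq_bigr => j _.
  by rewrite linearZ -scalerBr.
suff gv0 : g v = 0.
  by move/eqP: gv0; rewrite subr_eq0 => /eqP ->; apply: memv_proj.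
apply/rowP => j; rewrite [RHS]mxE; apply/eqP; apply: contraT => gvj.
pose B := \sum_k C * `|g (delta_mx 0 k) 0 j|.
have gv_le m : `|g v 0 j| *+ m <= B.
  have [w Lw wC] := close m.
  have gvm : g (v *+ m - w) = g v *+ m by rewrite gB // /g raddfMn /= mulrnBl.
  rewrite -normrMn -mulmxnE -gvm gE summxE (le_trans (ler_norm_sum _ _ _)) //.
  by apply: ler_sum => k' _; rewrite mxE normrM ler_wpM2r.
have gvj_gt0 : 0 < `|g v 0 j| by rewrite normr_gt0.
have := gv_le (Num.truncn (B / `|g v 0 j|)).+1.
by rewrite leNgt -mulr_natl -ltr_pdivrMr // truncnS_gt.
Qed.

(** * The hyperplane of coordinate sum 0 and the covering radius *)

Section Span.
Variables (R : realType) (K : fieldExtType rat) (r1 r2 : nat).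
Variable sigma : 'I_(r1 + r2) -> {rmorphism K -> R[i]}.
Hypothesis sigma_places : is_place_enum sigma.
Local Notation d := (\dim {:K}).
Local Notation OK := (ring_of_integers K).

(** All multiples of [v] have coordinate sum 0 too, so they stay at bounded distance from the
    log-unit lattice. *)
Lemma sum0_log_unit_span (v : 'rV[R]_(r1 + r2)) :
  \sum_k v 0 k = 0 -> log_unit_span sigma v.
Proof.
move=> sumv.
have [tau [tau_all tau_inj]] := exists_embeddings K R[i].
have /choice[f fP] (i : 'I_d) : exists k, above sigma (tau i) k.
  by have [k [kP _]] := place_exhaustive sigma_places (tau i); exists k.
have [C CP] := log_embedding_unit_close sigma_places tau_all tau_inj fP.
apply: (@span_of_bounded_distance _ _ _ _ C) => m.
have [|u uu uC] := CP (v *+ m).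
  by under eq_bigr do rewrite mulmxnE; rewrite sumrMnl sumv mul0rn.
by exists (log_embedding sigma (OK_val u)) => //; exists u.
Qed.

Lemma covering_radius_strictly_large (A : set OK) :
  is_principal A -> A <> [set 0] ->
  (covering_radius sigma < (log_norm R A)%:E)%E -> strictly_large R A.
Proof.
case=> a -> A_neq0 lt_n.
have a_neq0 : a != 0.
  apply/eqP => a0; apply: A_neq0; rewrite a0.
  apply/seteqP; split=> [_ [y _ <-]|_ ->] /=.
    by rewrite mul0r.
  by exists 0; rewrite ?mul0r.
have [tau [tau_all tau_inj]] := exists_embeddings K R[i].
have /choice[f fP] (i : 'I_d) : exists k, above sigma (tau i) k.
  by have [k [kP _]] := place_exhaustive sigma_places (tau i); exists k.
set n := log_norm R _ in lt_n.
pose e (k : 'I_(r1 + r2)) : R := (place_mult k)%:R.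
(* The coordinates of l(a) sum to n d and the [e k] sum to d, so [v] has coordinate sum 0. *)
pose v : 'rV[R]_(r1 + r2) :=
  \row_k (log_embedding sigma (OK_val a) 0 k - n * e k).
have d_gt0 : 0 < d%:R :> R by rewrite ltr0n dim_gt0.
have sume : \sum_k e k = d%:R.
  have := sum_above sigma_places tau_all tau_inj fP (fun=> 1 : R).
  rewrite sumr_const card_ord => ->.
  by apply: eq_bigr => k _; rewrite mulr1.
have sumv : \sum_k v 0 k = 0.
  under eq_bigr do rewrite mxE.
  rewrite sumrB -mulr_sumr sume.
  rewrite (sum_log_embedding sigma_places tau_all tau_inj fP) //.
  by rewrite /n /log_norm divfK ?gt_eqF // subrr.
(* The distance from [v] to the lattice is an infimum below [n], so some unit [u] has its log vector
   closer to [v] than [n]. *)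
have [_ [_ [u [u' uu'] <-] <-]] : exists2 y,
    [set `|v - w|%:E | w in log_unit_lattice sigma] y & (y < n%:E)%E.
  apply: ereal_inf_lt; apply: le_lt_trans lt_n.
  apply: ereal_sup_ubound; exists v => //; exact: sum0_log_unit_span.
rewrite lte_fin => vu_lt.
have u_neq0 : u != 0.
  by apply: contra_eq_neq uu' => ->; rewrite mul0r eq_sym oner_eq0.
exists (a * u'); split.
  by rewrite (ideal_gen_mul_unit a (v := u)) // mulrC.
move=> rho; have [i iE] := tau_all rho.
rewrite iE (cmod_above (fP i)); set k := f i.
have au : cmod (sigma k (OK_val a)) =
    cmod (sigma k (OK_val (a * u'))) * cmod (sigma k (OK_val u)).
  by rewrite -cmodM -rmorphM -rmorphM -mulrA (mulrC u') uu' mulr1.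
have au'_neq0 : a * u' != 0.
  apply: contra_neq a_neq0 => au'0.
  by rewrite -[a]mulr1 -uu' mulrCA au'0 mulr0.
have := mx_norm_entry (v - log_embedding sigma (OK_val u)) k.
move/le_lt_trans => /(_ _ vu_lt).
rewrite ltr_norml => /andP[lt_k _]; move: lt_k.
have -> : (v - log_embedding sigma (OK_val u)) 0 k =
    log_embedding sigma (OK_val a) 0 k - n * e k -
    log_embedding sigma (OK_val u) 0 k by rewrite !mxE.
rewrite !log_embeddingE au lnM ?posrE ?cmod_rmorph_gt0 //.
set x := ln (cmod (sigma k (OK_val (a * u')))).
rewrite -/(e k) mulrDr => lt_k.
(* [n] exceeds a norm, so it is positive; [lt_k] amounts to e_k x > n (e_k - 1), and the right side
   is nonnegative as e_k >= 1. *)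
have n_gt0 : 0 < n by apply: le_lt_trans vu_lt.
have e_ge1 : 1 <= e k by rewrite ler1n /place_mult; case: ifP.
have ex_gt0 : 0 < e k * x.
  have : n <= n * e k by rewrite ler_peMr // ltW.
  by move: lt_k; lra.
have e_gt0 : 0 < e k by apply: lt_le_trans e_ge1.
have : 0 < x by rewrite -(pmulr_rgt0 _ e_gt0).
by rewrite -ln1 ltr_ln ?posrE ?cmod_rmorph_gt0.
Qed.

End Span.

Theorem proposition2p3 (R : realType) (K : fieldExtType rat) :
  (forall (r1 r2 : nat) (sigma : 'I_(r1 + r2) -> {rmorphism K -> R[i]}),
     is_place_enum sigma ->
     forall A : set (ring_of_integers K),
       is_principal A -> A <> [set 0] ->
       (covering_radius sigma < (log_norm R A)%:E)%E ->
       strictly_large R A)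
  /\ finite_set [set A : set (ring_of_integers K) | is_principal A /\ ~ strictly_large R A].
Proof.
split; last exact: finite_not_strictly_large.
by move=> r1 r2 sigma places A; apply: covering_radius_strictly_large.
Qed.
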